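(* Let $A$ be an associative algebra over a field $K$ and let $(M,\circ,\triangleright,\triangleleft,R,S)$ be an extended $A$-bimodule algebra. Define linear maps $\succ:M\otimes A\to A$, $\prec:A\otimes M\to A$ and $\gtrdot,\lessdot:M\otimes M\to M$ by $$x\succ a=R(x)a,\quad a\prec x=aS(x),\quad x\gtrdot y=R(x)\triangleright y,\quad x\lessdot y=x\triangleleft S(y)+x\circ y,$$ for $x,y\in M$, $a\in A$. If $(A,M,R,S,\circ)$ is a curved $\mathcal{O}$-operator system associated to $(M,\triangleright,\triangleleft)$, then $(M,A,\lessdot,\gtrdot,\prec,\succ)$ is a dendriform system.
   Context: All vector spaces, linear maps and tensor products are over a field $K$; associative algebras are not assumed to be unital. An $A$-bimodule $(M,\triangleright,\triangleleft)$ is a vector space $M$ with linear maps $\triangleright:A\otimes M\to M$, $\triangleleft:M\otimes A\to M$ such that $a\triangleright(b\triangleright x)=(ab)\triangleright x$, $(x\triangleleft a)\triangleleft b=x\triangleleft(ab)$, $(a\triangleright x)\triangleleft b=a\triangleright(x\triangleleft b)$ for all $a,b\in A$, $x\in M$. Extended $A$-bimodule algebra: let $A$ and $(M,\circ)$ be associative algebras and $\triangleright:A\otimes M\to M$, $\triangleleft:M\otimes A\to M$, $R,S:M\to A$ linear maps. $(M,\circ,\triangleright,\triangleleft,R,S)$ is an extended $A$-bimodule algebra if $(M,\triangleright,\triangleleft)$ is an $A$-bimodule and for all $x,y,z\in M$: $R(x)\triangleright(y\circ z)=(R(x)\triangleright y)\circ z$, $(x\circ y)\triangleleft S(z)=x\circ(y\triangleleft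 S(z))$, $x\circ(R(y)\triangleright z)=(x\triangleleft S(y))\circ z$. Curved $\mathcal{O}$-operator system: for an associative algebra $A$, an $A$-bimodule $(M,\triangleright,\triangleleft)$, linear maps $R,S:M\to A$ and a bilinear operation $\circ$ on $M$, $(A,M,R,S,\circ)$ is a curved $\mathcal{O}$-operator system associated to $(M,\triangleright,\triangleleft)$ if for all $x,y\in M$: $R(x)R(y)=R(R(x)\triangleright y+x\triangleleft S(y)+x\circ y)$ and $S(x)S(y)=S(R(x)\triangleright y+x\triangleleft S(y)+x\circ y)$. Dendriform system: a tuple $(B,N,\prec_B,\succ_B,\prec_N,\succ_N)$ of vector spaces $B,N$ and linear maps $\prec_B,\succ_B:B\otimes B\to B$, $\prec_N:N\otimes B\to N$, $\succ_N:B\otimes N\to N$ such that for all $a,b,c\in B$, $n\in N$: (i) $(a\prec_B b)\prec_B c=a\prec_B(b\succ_B c+b\prec_B c)$, $a\succ_B(b\prec_B c)=(a\succ_B b)\prec_B c$, $a\succ_B(b\succ_B c)=(a\succ_B b+a\prec_B b)\succ_B c$; (ii) $(n\prec_N a)\prec_N b=n\prec_N(a\succ_B b+a\prec_B b)$, $a\succ_N(n\prec_N b)=(a\succ_N n)\prec_N b$, $a\succ_N(b\succ_N n)=(a\succ_B b+a\prec_B b)\succ_N n$. In the claim, $B=M$, $N=A$, $\prec_B=\lessdot$, $\succ_B=\gtrdot$, $\prec_N=\prec$, $\succ_N=\succ$. *)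

(* Defs.v *)
From mathcomp Require Import all_boot all_algebra.

Set Implicit Arguments.
Unset Strict Implicit.
Unset Printing Implicit Defensive.

Import GRing.Theory.
Local Open Scope ring_scope.

(* A linear map U (x) V -> W is encoded as a bilinear map U -> V -> W.        *)
Notation is_bilinear f := (bilinear_for *:%R *:%R f).

Section Structures.
Variable K : fieldType.

(* Non-unital, hence not an instance of mathcomp's algType.                   *)
Record assoc_algebra (A : lmodType K) (mul : A -> A -> A) : Prop :=
  AssocAlgebra {
    assoc_algebra_bilinear : is_bilinear mul;
    assoc_algebra_assoc : associative mul
  }.

Section Bimodules.
Variables (A M : lmodType K) (mul : A -> A -> A).

Record bimodule (lact : A -> M -> M) (ract : M -> A -> M) : Prop := Bimodule {
  bimodule_lact_bilinear : is_bilinear lact;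
  bimodule_ract_bilinear : is_bilinear ract;
  bimodule_lactA : forall a b x, lact a (lact b x) = lact (mul a b) x;
  bimodule_ractA : forall x a b, ract (ract x a) b = ract x (mul a b);
  bimodule_lractA : forall a x b, ract (lact a x) b = lact a (ract x b)
}.

Record extended_bimodule_algebra (circ : M -> M -> M)
    (lact : A -> M -> M) (ract : M -> A -> M) (R S : {linear M -> A}) : Prop :=
  ExtendedBimoduleAlgebra {
    eba_base : assoc_algebra mul;
    eba_circ : assoc_algebra circ;
    eba_bimodule : bimodule lact ract;
    eba_lact_circ : forall x y z,
      lact (R x) (circ y z) = circ (lact (R x) y) z;
    eba_circ_ract : forall x y z,
      ract (circ x y) (S z) = circ x (ract y (S z));
    eba_circ_lact : forall x y z,
      circ x (lact (R y) z) = circ (ract x (S y)) z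
  }.

(* Here circ is only bilinear; it need not be associative.                    *)
Record curved_O_operator_system (lact : A -> M -> M) (ract : M -> A -> M)
    (R S : {linear M -> A}) (circ : M -> M -> M) : Prop :=
  CurvedOOperatorSystem {
    coos_base : assoc_algebra mul;
    coos_bimodule : bimodule lact ract;
    coos_circ_bilinear : is_bilinear circ;
    coos_R : forall x y,
      mul (R x) (R y) = R (lact (R x) y + ract x (S y) + circ x y);
    coos_S : forall x y,
      mul (S x) (S y) = S (lact (R x) y + ract x (S y) + circ x y)
  }.

End Bimodules.

Record dendriform_system (B N : lmodType K)
    (precB succB : B -> B -> B)
    (precN : N -> B -> N) (succN : B -> N -> N) : Prop := DendriformSystem {
  dend_precB_bilinear : is_bilinear precB;
  dend_succB_bilinear : is_bilinear succB;
  dend_precN_bilinear : is_bilinear precN;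
  dend_succN_bilinear : is_bilinear succN;
  dend_precB_precB : forall a b c,
    precB (precB a b) c = precB a (succB b c + precB b c);
  dend_succB_precB : forall a b c,
    succB a (precB b c) = precB (succB a b) c;
  dend_succB_succB : forall a b c,
    succB a (succB b c) = succB (succB a b + precB a b) c;
  dend_precN_precN : forall n a b,
    precN (precN n a) b = precN n (succB a b + precB a b);
  dend_succN_precN : forall a n b,
    succN a (precN n b) = precN (succN a n) b;
  dend_succN_succN : forall a b n,
    succN a (succN b n) = succN (succB a b + precB a b) n
}.

End Structures.

(* Main.v *)
Require Import Defs.
From mathcomp Require Import all_boot all_algebra.

Set Implicit Arguments.
Unset Strict Implicit.
Unset Printing Implicit Defensive.

Import GRing.Theory.
Local Open Scope ring_scope.

(** Since [x gtrdot y + x lessdot y] equals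
    [lact (R x) y + ract x (S y) + circ x y], the curved O-operator equations
    say that [R] and [S] both turn the total product of the two operations
    on [M] into the product of [A].  Hence the three axioms on [A] reduce to
    associativity of the product of [A], and the axiom for an iterated [gtrdot]
    reduces to [lact] being a left action.  In the remaining two axioms, those
    on [M] that involve [lessdot], the terms without [circ] are matched by the
    bimodule axioms, and the terms with [circ] by the compatibilities of the
    extended bimodule algebra and by associativity of [circ]. *)

Section Bilinear.
Variables (K : fieldType) (U V W X : lmodType K).

Lemma is_bilinearDl (f : U -> V -> W) :
  is_bilinear f -> forall u u' v, f (u + u') v = f u v + f u' v.
Proof. by move=> [fl _] u u' v; have := fl v 1 u u'; rewrite /= !scale1r. Qed.

Lemma is_bilinearDr (f : U -> V -> W) :
  is_bilinear f -> forall u v v', f u (v + v') = f u v + f u v'.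
Proof. by move=> [_ fr] u v v'; have := fr u 1 v v'; rewrite /= !scale1r. Qed.

Lemma is_bilinearD (f g : U -> V -> W) :
  is_bilinear f -> is_bilinear g -> is_bilinear (fun u v => f u v + g u v).
Proof.
move=> [fl fr] [gl gr]; split=> [v | u] k x y /=.
  by rewrite fl gl scalerDr addrACA.
by rewrite fr gr scalerDr addrACA.
Qed.

Lemma is_bilinear_precompl (f : U -> V -> W) (h : {linear X -> U}) :
  is_bilinear f -> is_bilinear (fun x v => f (h x) v).
Proof.
move=> [fl fr]; split=> [v | x] k y z /=; last exact: fr.
by rewrite linearP; exact: fl.
Qed.

Lemma is_bilinear_precompr (f : U -> V -> W) (h : {linear X -> V}) :
  is_bilinear f -> is_bilinear (fun u x => f u (h x)).
Proof.
move=> [fl fr]; split=> [x | u] k y z /=; first exact: fl.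
by rewrite linearP; exact: fr.
Qed.

End Bilinear.

Theorem theorem3p21 (K : fieldType) (A M : lmodType K) (mul : A -> A -> A)
    (circ : M -> M -> M) (lact : A -> M -> M) (ract : M -> A -> M)
    (R S : {linear M -> A}) :
  assoc_algebra mul ->
  extended_bimodule_algebra mul circ lact ract R S ->
  let succ : M -> A -> A := fun x a => mul (R x) a in
  let prec : A -> M -> A := fun a x => mul a (S x) in
  let gtrdot : M -> M -> M := fun x y => lact (R x) y in
  let lessdot : M -> M -> M := fun x y => ract x (S y) + circ x y in
  curved_O_operator_system mul lact ract R S circ ->
  dendriform_system lessdot gtrdot prec succ.
Proof.
move=> [mulB mulA] [_ [circB circA] [lactB ractB lactA ractA lractA]].
move=> lact_circ circ_ract circ_lact succ prec gtrdot lessdot [_ _ _ mulR mulS].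
split=> [||||x y z|x y z|x y z|a x y|x a y|x y a];
  rewrite /lessdot /gtrdot /prec /succ.
- exact: is_bilinearD (is_bilinear_precompr S ractB) circB.
- exact: is_bilinear_precompl.
- exact: is_bilinear_precompr.
- exact: is_bilinear_precompl.
- rewrite addrA -mulS (is_bilinearDl ractB) (is_bilinearDl circB) ractA.
  rewrite !(is_bilinearDr circB) circ_lact -circ_ract circA.
  by rewrite -!addrA; congr (_ + _); rewrite addrCA.
- by rewrite (is_bilinearDr lactB) lact_circ lractA.
- by rewrite addrA -mulR lactA.
- by rewrite addrA -mulS mulA.
- by rewrite mulA.
- by rewrite addrA -mulR mulA.
Qed.
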